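(* The following assertion is false. ''Let $(\Omega,\mathcal A)$ be a measurable space, let $\mathcal P$ be a nonempty set of probability measures on it, let $\mathbb V(A)=\sup_{Q\in\mathcal P}Q(A)$ be the corresponding upper probability and $\mathbb E[X]=\sup_{Q\in\mathcal P}E_Q[X]$ the associated upper expectation. Let $\{X_n\}_{n\in\mathbb N}$ be a sequence of real random variables on $(\Omega,\mathcal A)$ such that: (i) $\mathbb V$ is continuous; (ii) $\{X_n\}_n$ is negatively dependent and identically distributed with respect to $\mathbb E$; (iii) $\mathbb E[e^{\delta|X_i|}]<\infty$ for all $\delta>0$ and $i\in\mathbb N$; (iv) for every $\lambda\in\mathbb R$ the limit $\Lambda(\lambda)=\lim_{n}\frac1n\sum_{i=1}^n\ln\mathbb E[e^{\lambda X_i}]$ exists in $[-\infty,\infty]$; (v) $0\in\mathrm{int}(\mathrm{dom}(\Lambda))$. Then, with $\overline X_n=\frac1n\sum_{i=1}^nX_i$, for all closed $F\subset\mathbb R$ and all open $G\subset\mathbb R$, $$\limsup_{n\to\infty}\frac1n\ln\mathbb V(\overline X_n\in F)\le-\inf_{x\in F}\Lambda^*(x)$$ and $$\liminf_{n\to\infty}\frac1n\ln\mathbb V(\overline X_n\in G)\ge-\inf_{x\in G\cap\mathcal E(\Lambda^* )}\Lambda^*(x).''$$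
   Context: Conventions: $\ln 0=-\infty$, $\inf\emptyset=+\infty$. $E_Q$ is expectation with respect to a probability measure $Q$. A set function $\mathbb V:\mathcal A\to[0,1]$ is continuous if $\mathbb V(A_n)\to\mathbb V(A)$ whenever $A_n\nearrow A$ or $A_n\searrow A$. Random variables $\{X_n\}$ are negatively dependent with respect to $\mathbb E$ if for any $n\in\mathbb N$ and any Borel functions $\varphi_i:\mathbb R\to[0,\infty)$, $$\mathbb E[\varphi_1(X_1)\cdots\varphi_{n+1}(X_{n+1})]\le\mathbb E[\varphi_1(X_1)\cdots\varphi_n(X_n)]\cdot\mathbb E[\varphi_{n+1}(X_{n+1})]$$ whenever the upper expectations are finite. They are identically distributed with respect to $\mathbb E$ if for any $i,j$ and any Borel $\varphi:\mathbb R\to[0,\infty)$, $\mathbb E[\varphi(X_i)]=\mathbb E[\varphi(X_j)]$ whenever the upper expectations are finite. $\mathrm{dom}(f)=\{x\in\mathbb R: f(x)<\infty\}$; $f^*(x)=\sup_{\lambda\in\mathbb R}(\lambda x-f(\lambda))$ is the Fenchel–Legendre transform. A point $y\in\mathbb R$ is an exposed point of $f^*$ with exposing hyperplane $\lambda\in\mathbb R$ if $\lambda y-f^*(y)>\lambda x-f^*(x)$ for all $x\ne y$. $\mathcal E(\Lambda^* )$ is the set of exposed points of $\Lambda^*$ admitting an exposing hyperplane $\lambda\in\mathrm{int}(\mathrm{dom}(\Lambda))$. *)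

(* Defs.v *)
From HB Require Import structures.
From mathcomp Require Export all_boot all_order all_algebra.
From mathcomp Require Export all_classical all_reals all_analysis.

Set Implicit Arguments.
Unset Strict Implicit.
Unset Printing Implicit Defensive.

Export Order.TTheory GRing.Theory Num.Theory.
Export numFieldNormedType.Exports.

Local Open Scope classical_set_scope.
Local Open Scope ring_scope.
Local Open Scope ereal_scope.

(* Sequences are indexed from 0 in Rocq: [X i] below is the random variable
   usually written X_(i+1). *)

Definition upper_prob (R : realType) (d : measure_display)
    (T : measurableType d) (P : set (probability T R)) (A : set T) : \bar R :=
  ereal_sup [set Q A | Q in P].

Definition upper_expectation (R : realType) (d : measure_display)
    (T : measurableType d) (P : set (probability T R)) (Y : T -> R) : \bar R :=
  ereal_sup [set 'E_Q[Y] | Q in P].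

Definition continuous_setfun (R : realType) (d : measure_display)
    (T : measurableType d) (V : set T -> \bar R) : Prop :=
  (forall A : nat -> set T, (forall n, measurable (A n)) ->
     nondecreasing_seq A -> V (A n) @[n --> \oo] --> V (\bigcup_n A n)) /\
  (forall A : nat -> set T, (forall n, measurable (A n)) ->
     nonincreasing_seq A -> V (A n) @[n --> \oo] --> V (\bigcap_n A n)).

Definition nonneg_borel (R : realType) (phi : R -> R) : Prop :=
  measurable_fun [set: R] phi /\ forall x, (0 <= phi x)%R.

Definition negatively_dependent (R : realType) (d : measure_display)
    (T : measurableType d) (P : set (probability T R))
    (X : nat -> {mfun T >-> R}) : Prop :=
  forall (n : nat) (phi : nat -> R -> R), (0 < n)%N ->
    (forall i, nonneg_borel (phi i)) ->
    let prod_upto m := fun w : T => (\prod_(i < m) phi i (X i w))%R in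
    upper_expectation P (prod_upto n.+1) < +oo ->
    upper_expectation P (prod_upto n) < +oo ->
    upper_expectation P (fun w => phi n (X n w)) < +oo ->
    upper_expectation P (prod_upto n.+1) <=
      upper_expectation P (prod_upto n) *
      upper_expectation P (fun w => phi n (X n w)).

Definition identically_distributed (R : realType) (d : measure_display)
    (T : measurableType d) (P : set (probability T R))
    (X : nat -> {mfun T >-> R}) : Prop :=
  forall (i j : nat) (phi : R -> R), nonneg_borel phi ->
    upper_expectation P (fun w => phi (X i w)) < +oo ->
    upper_expectation P (fun w => phi (X j w)) < +oo ->
    upper_expectation P (fun w => phi (X i w)) =
    upper_expectation P (fun w => phi (X j w)).

Definition sample_mean (R : realType) (d : measure_display)
    (T : measurableType d) (X : nat -> {mfun T >-> R}) (n : nat) (w : T) : R :=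
  (n%:R^-1 * \sum_(i < n) X i w)%R.

(* [lne] is the extended logarithm, with value -oo at 0. *)
Definition mean_log_mgf (R : realType) (d : measure_display)
    (T : measurableType d) (P : set (probability T R))
    (X : nat -> {mfun T >-> R}) (l : R) (n : nat) : \bar R :=
  (n%:R^-1)%:E *
  \sum_(i < n) lne (upper_expectation P (fun w => expR (l * X i w)%R)).

Definition limit_log_mgf (R : realType) (d : measure_display)
    (T : measurableType d) (P : set (probability T R))
    (X : nat -> {mfun T >-> R}) (l : R) : \bar R :=
  limn (mean_log_mgf P X l).

Definition edom (R : realType) (f : R -> \bar R) : set R :=
  [set x | f x < +oo].

Definition fenchel_legendre (R : realType) (f : R -> \bar R) (x : R) : \bar R :=
  ereal_sup [set (l * x)%:E - f l | l in [set: R]].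

Definition exposing_hyperplane (R : realType) (g : R -> \bar R) (y l : R) :
    Prop :=
  forall x : R, x <> y -> (l * x)%:E - g x < (l * y)%:E - g y.

Definition exposed_points (R : realType) (f : R -> \bar R) : set R :=
  [set y | exists l : R, interior (edom f) l /\
                         exposing_hyperplane (fenchel_legendre f) y l].

(* Main.v *)
Require Import Defs.
From HB Require Import structures.
From mathcomp Require Import lra zify.

Local Open Scope classical_set_scope.
Local Open Scope ring_scope.
Local Open Scope ereal_scope.

(** Negative dependence in this sense does not prevent a single model in P from
    having non-identically distributed coordinates. On a two-point space, let P
    consist of the two Dirac measures and let X_i alternate deterministically
    between 0 and 1, in opposite phase at the two points. The upper log-mgf of
    every X_i is max(0, l), so the candidate rate function vanishes on [0, 1] and
    0 is an exposed point; yet both sample means tend to 1/2, so that small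
    neighbourhoods of 0 eventually have upper probability 0. *)

Lemma measurable_fun_from_bool d (U : measurableType d) (D : set bool)
  (f : bool -> U) : measurable_fun D f.
Proof. by []. Qed.

(** On a two-point space a monotone sequence of sets is eventually equal to its limit, so [V] is
    eventually constant along it. *)
Lemma continuous_setfun_bool (R : realType) (V : set bool -> \bar R) :
  continuous_setfun V.
Proof.
have stable (A : nat -> set bool) (L : set bool) :
    (forall w, \forall n \near \oo, A n w <-> L w) ->
    V (A n) @[n --> \oo] --> V L.
  move=> AL; apply: cvg_near_cst.
  have {AL} := (AL true, AL false) => -[ALt ALf].
  near=> n; congr V; apply/seteqP; split=> -[]; near: n.
  - by apply: filterS ALt => n [].
  - by apply: filterS ALf => n [].
  - by apply: filterS ALt => n [].
  - by apply: filterS ALf => n [].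
split=> A _ monoA; apply: stable => w.
- have [[n _ Anw]|noA] := pselect ((\bigcup_n A n) w).
    exists n => // m /= nm; split=> _; first by exists n.
    by have /subsetPset := monoA _ _ nm; exact.
  by near=> n; split=> // Anw; exfalso; apply: noA; exists n.
- have [allA|] := pselect ((\bigcap_n A n) w).
    by near=> n; split=> // _; exact: allA.
  move=> nallA; have /existsNP[n Anw] : ~ forall n, A n w.
    by move=> allA; apply: nallA => n _; exact: allA.
  exists n => // m /= nm; split=> [Amw|]; last by move=> /(_ m I).
  by exfalso; apply: Anw; have /subsetPset := monoA _ _ nm; exact.
Unshelve. all: by end_near. Qed.

Definition dirac_family (R : realType) : set (probability bool R) :=
  range (fun w : bool => \d_w : probability bool R).

Lemma upper_prob_dirac_family0 (R : realType) :
  upper_prob (dirac_family R) set0 = 0.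
Proof.
rewrite /upper_prob (_ : [set _ | _ in _] = [set 0]) ?ereal_sup1//.
apply/seteqP; split=> [_ [Q _ <-]|_ ->]/=; first by rewrite measure0.
by exists (\d_true : probability bool R); [exists true|rewrite measure0].
Qed.

Lemma upper_expectation_dirac_family (R : realType) (Y : bool -> R) :
  upper_expectation (dirac_family R) Y = (Num.max (Y false) (Y true))%:E.
Proof.
have E_dirac w : 'E_(\d_w : probability bool R)[Y] = (Y w)%:E.
  by rewrite unlock integral_dirac// diracT mul1e.
apply/eqP; rewrite eq_le; apply/andP; split.
  apply: ge_ereal_sup => _ [_ [w _ <-] <-]; rewrite E_dirac lee_fin le_max.
  by case: w; rewrite lexx ?orbT.
rewrite EFin_max ge_max; apply/andP; split; apply: ereal_sup_ubound;
  [exists (\d_false : probability bool R)|exists (\d_true : probability bool R)];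
  rewrite ?E_dirac//; [by exists false|by exists true].
Qed.

Definition alternating (R : realType) (i : nat) (w : bool) : R :=
  (odd i (+) w)%:R.

HB.instance Definition _ (R : realType) (i : nat) :=
  isMeasurableFun.Build _ _ bool R (alternating R i)
    (measurable_fun_from_bool _ _ _ _).

Definition alternating_rv (R : realType) (i : nat) : {mfun bool >-> R} :=
  alternating R i.

(** For each [i], the two points of [bool] produce the two values 0 and 1; the parity of [i] only
    swaps them, which the maximum does not see. *)
Lemma upper_expectation_alternating (R : realType) (phi : R -> R) (i : nat) :
  upper_expectation (dirac_family R) (fun w => phi (alternating_rv R i w)) =
  (Num.max (phi 0%R) (phi 1%R))%:E.
Proof.
rewrite upper_expectation_dirac_family /alternating_rv/= /alternating.
by case: odd; rewrite //= maxC.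
Qed.

Lemma alternating_identically_distributed (R : realType) :
  identically_distributed (dirac_family R) (alternating_rv R).
Proof. by move=> i j phi _ _ _; rewrite !upper_expectation_alternating. Qed.

(** The upper expectation is a maximum over points, and a maximum of products of nonnegative
    functions is at most the product of their maxima. *)
Lemma alternating_negatively_dependent (R : realType) :
  negatively_dependent (dirac_family R) (alternating_rv R).
Proof.
move=> n phi _ phi_ge0 prod_upto _ _ _.
have prod_ge0 w : (0 <= prod_upto n w)%R.
  by apply: prodr_ge0 => i _; exact: (phi_ge0 i).2.
rewrite !upper_expectation_dirac_family -EFinM lee_fin ge_max.
(* Occurrences 1 and 4 are the products of [n.+1] factors, one for each point; only these are
   split. *)
rewrite {1 4}/prod_upto !big_ord_recr/= -!/(prod_upto n _).
by apply/andP; split; apply: ler_pM;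
  rewrite ?prod_ge0 ?(phi_ge0 n).2 ?le_max ?lexx ?orbT.
Qed.

(** All summands equal [Num.max 0 l], hence so does their mean. At [n = 0] the convention for the
    inverse of 0 would give 0 instead. *)
Lemma mean_log_mgf_alternating (R : realType) (l : R) (n : nat) : (0 < n)%N ->
  mean_log_mgf (dirac_family R) (alternating_rv R) l n = (Num.max 0%R l)%:E.
Proof.
move=> n_gt0; rewrite /mean_log_mgf.
have lmgf i : lne (upper_expectation (dirac_family R)
    (fun w => expR (l * alternating_rv R i w)%R)) = (Num.max 0%R l)%:E.
  rewrite (upper_expectation_alternating _ (fun x => expR (l * x)%R)).
  rewrite mulr0 mulr1 (_ : Num.max _ _ = expR (Num.max 0%R l)); last first.
    by rewrite !maxEle ler_expR; case: ifP.
  by rewrite lne_EFin ?expR_gt0// expRK.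
rewrite (eq_bigr _ (fun (i : 'I_n) _ => lmgf i)) sumEFin sumr_const card_ord.
by rewrite -EFinM -[(Num.max _ _ *+ n)%R]mulr_natl mulKf// pnatr_eq0 -lt0n.
Qed.

Lemma cvg_mean_log_mgf_alternating (R : realType) (l : R) :
  mean_log_mgf (dirac_family R) (alternating_rv R) l n @[n --> \oo] -->
  (Num.max 0%R l)%:E.
Proof.
apply: cvg_near_cst.
by exists 1%N => // n /= n_gt0; exact: mean_log_mgf_alternating.
Qed.

Lemma limit_log_mgf_alternating (R : realType) :
  limit_log_mgf (dirac_family R) (alternating_rv R) =
  fun l => (Num.max 0%R l)%:E.
Proof.
by apply/funext => l; apply: cvg_lim => //; exact: cvg_mean_log_mgf_alternating.
Qed.

Lemma fenchel_legendre_ge (R : realType) (f : R -> \bar R) (x l : R) :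
  (l * x)%:E - f l <= fenchel_legendre f x.
Proof. by apply: ereal_sup_ubound; exists l. Qed.

Lemma fenchel_legendre_max0 (R : realType) :
  fenchel_legendre (fun l : R => (Num.max 0%R l)%:E) 0%R = 0.
Proof.
apply/eqP; rewrite eq_le; apply/andP; split.
  apply: ge_ereal_sup => _ [l _ <-].
  by rewrite mulr0 sub0e -EFinN lee_fin oppr_le0 le_max lexx.
by have := fenchel_legendre_ge _ (fun l : R => (Num.max 0%R l)%:E) 0 0;
  rewrite mulr0 maxxx sube0.
Qed.

Lemma edom_max0 (R : realType) : edom (fun l : R => (Num.max 0%R l)%:E) = setT.
Proof. by apply/seteqP; split=> // l _; rewrite /edom/= ltry. Qed.

(** The transform is 0 on [0, 1] and infinite elsewhere, so a line of negative slope touches it only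
    at 0. With slope -1, it suffices to bound the transform at each other [x] below by some
    [y > - x]. *)
Lemma exposed_point_max0 (R : realType) :
  exposed_points (fun l : R => (Num.max 0%R l)%:E) 0%R.
Proof.
exists (-1)%R; split; first by rewrite edom_max0 interiorT.
move=> x x_neq0; rewrite fenchel_legendre_max0 mulr0 sube0 mulN1r.
suff [y yx yg] : exists2 y : R, (- x < y)%R &
    y%:E <= fenchel_legendre (fun l : R => (Num.max 0%R l)%:E) x.
  apply: (@le_lt_trans _ _ ((- x)%:E - y%:E)); first exact: leeB.
  by rewrite -EFinB lte_fin subr_lt0.
have [x_gt0|x_le0] := ltP 0%R x.
  exists 0%R; first by rewrite oppr_lt0.
  have := fenchel_legendre_ge _ (fun l : R => (Num.max 0%R l)%:E) x 0.
  by rewrite mul0r maxxx sube0.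
(* For [x < 0], any slope [l < -1] gives the bound [l * x > - x]; here [l = -2]. *)
exists (-2 * x)%R; first by move/eqP: x_neq0; lra.
have := fenchel_legendre_ge _ (fun l : R => (Num.max 0%R l)%:E) x (-2).
by rewrite (max_idPl _) ?sube0//; lra.
Qed.

(** Two consecutive indices contribute exactly one 1; the phase [w] decides which comes first, and
    so the rounding in the exact count used for the induction. *)
Lemma half_le_sum_alternating (n : nat) (w : bool) :
  (n./2 <= \sum_(i < n) (odd i (+) w))%N.
Proof.
suff -> : (\sum_(i < n) (odd i (+) w) = (n + w)./2)%N.
  by apply: half_leq; exact: leq_addr.
elim: n => [|n IHn]; first by rewrite big_ord0; case: w.
rewrite big_ord_recr/= IHn; case: w {IHn}; rewrite ?addbT ?addbF; lia.
Qed.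

(** The bound 1/4 lies below the limit 1/2 and holds as soon as [n] is 2, since then
    [n <= n./2 * 4]; for [n = 1] the mean can be 0. *)
Lemma sample_mean_alternating_ge (R : realType) (n : nat) (w : bool) :
  (1 < n)%N -> (4^-1 <= sample_mean (alternating_rv R) n w)%R.
Proof.
move=> n_gt1; rewrite /sample_mean mulrC ler_pdivlMr ?ltr0n; last by lia.
rewrite mulrC ler_pdivrMr// -natr_sum -natrM ler_nat.
apply: leq_trans (leq_mul (half_le_sum_alternating n w) (leqnn 4)); lia.
Qed.

Theorem corollary3p5 (R : realType) :
  ~ (forall (d : measure_display) (T : measurableType d)
        (P : set (probability T R)) (X : nat -> {mfun T >-> R}),
      P !=set0 ->
      continuous_setfun (upper_prob P) ->
      negatively_dependent P X ->
      identically_distributed P X ->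
      (forall (delta : R) (i : nat), (0 < delta)%R ->
         upper_expectation P (fun w => expR (delta * `|X i w|)%R) < +oo) ->
      (forall l : R, cvgn (mean_log_mgf P X l)) ->
      interior (edom (limit_log_mgf P X)) 0%R ->
      (forall F : set R, closed F ->
         limn_esup (fun n => (n%:R^-1)%:E *
                      lne (upper_prob P (sample_mean X n @^-1` F)))
         <= - ereal_inf [set fenchel_legendre (limit_log_mgf P X) x
                        | x in F]) /\
      (forall G : set R, open G ->
         - ereal_inf [set fenchel_legendre (limit_log_mgf P X) x
                     | x in G `&` exposed_points (limit_log_mgf P X)]
         <= limn_einf (fun n => (n%:R^-1)%:E *
                         lne (upper_prob P (sample_mean X n @^-1` G))))).
Proof.
move=> /(_ _ bool (dirac_family R) (alternating_rv R)) [].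
- by exists (\d_true : probability bool R), true.
- exact: continuous_setfun_bool.
- exact: alternating_negatively_dependent.
- exact: alternating_identically_distributed.
- by move=> delta i _; rewrite upper_expectation_dirac_family ltry.
- by move=> l; apply/cvg_ex; exists (Num.max 0%R l)%:E;
    exact: cvg_mean_log_mgf_alternating.
- by rewrite limit_log_mgf_alternating edom_max0 interiorT.
(* The lower bound fails on the open half-line below 1/4: it contains the exposed point 0, but no
   sample mean with [n > 1] enters it. *)
move=> _ /(_ _ (@open_lt R 4^-1)).
rewrite limit_log_mgf_alternating.
set u := fun n : nat => _ * lne _.
have uNy : u n @[n --> \oo] --> -oo.
  apply: cvg_near_cst; exists 2%N => // n /= n_gt1.
  rewrite /u (_ : _ @^-1` _ = set0).
    by rewrite upper_prob_dirac_family0 le0_lneNy// gt0_muleNy// lte_fin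
      invr_gt0 ltr0n; lia.
  apply/seteqP; split=> // w /=; rewrite ltNge.
  by rewrite sample_mean_alternating_ge.
(* A lower limit of [-oo] forces the infimum of the rate to be [+oo], although the rate at 0 is
   0. *)
rewrite (cvg_limn_einf_sup uNy).1 leeNy_eq eqe_oppLR => /eqP inf_pinfty.
set S := [set _ | _ in _] in inf_pinfty.
suff : ereal_inf S <= 0 by rewrite inf_pinfty.
apply: ereal_inf_lbound; exists 0%R; last exact: fenchel_legendre_max0.
by split; [rewrite /= invr_gt0|exact: exposed_point_max0].
Qed.
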